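(* Let $\mathfrak{g}$ be a nonabelian real Lie algebra of finite dimension $n \geq 4$ which admits a Milnor frame, and suppose that $\mathfrak{g}$ is not isomorphic to $\mathfrak{h}^3 \oplus \mathfrak{a}$ for any abelian Lie algebra $\mathfrak{a}$. Then there exists a metric (inner product) $g$ on $\mathfrak{g}$ such that $(\mathfrak{g}, g)$ does not admit an orthonormal Milnor frame.
   Context: All Lie algebras are real and finite-dimensional; a frame is an ordered basis. For a Lie algebra $\mathfrak{g}$ of dimension $n \geq 4$, a frame $\{X_1,\ldots,X_n\}$ is called a Milnor frame if there exist $\lambda_1,\ldots,\lambda_n \in \mathbb{R}$ (the structure constants of the frame, possibly zero) such that, with all indices taken modulo $n$, for all $i,j$: $[X_i,X_j] = \lambda_{i+2}X_{i+2}$ if $j = i+1$; $[X_i,X_j] = -\lambda_{j+2}X_{j+2}$ if $i = j+1$; and $[X_i,X_j]=0$ otherwise. A metric on a Lie algebra $\mathfrak{g}$ is an inner product (positive definite symmetric bilinear form) $g$ on $\mathfrak{g}$, equivalently a left-invariant Riemannian metric on the associated simply connected Lie group. An orthonormal Milnor frame of $(\mathfrak{g},g)$ is a Milnor frame of $\mathfrak{g}$ that is orthonormal with respect to $g$. $\mathfrak{h}^3$ is the 3-dimensional Heisenberg Lie algebra: it has a basis $X_1,X_2,X_3$ with $[X_1,X_2]=X_3$ and all other brackets of basis elements (up to antisymmetry) zero. *)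

(* Defs.v *)
From HB Require Import structures.
From mathcomp Require Import all_boot all_order all_algebra.
From mathcomp Require Import sesquilinear ring.
From mathcomp Require Import reals.

Set Implicit Arguments.
Unset Strict Implicit.
Unset Printing Implicit Defensive.

Import Order.TTheory GRing.Theory Num.Theory.
Local Open Scope ring_scope.

(* Finite-dimensional Lie algebras: the dimension of g is \dim {:g}. *)
HB.mixin Record Vector_isLie (R : fieldType) (g : Type) of Vector R g := {
  lie_bracket : g -> g -> g;
  lie_bracket_linearl : forall y, linear (lie_bracket^~ y);
  lie_bracket_linearr : forall x, linear (lie_bracket x);
  lie_bracketxx : forall x, lie_bracket x x = 0;
  lie_jacobi : forall x y z,
    lie_bracket x (lie_bracket y z) + lie_bracket y (lie_bracket z x)
      + lie_bracket z (lie_bracket x y) = 0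
}.

#[short(type="lieAlgType")]
HB.structure Definition LieAlg (R : fieldType) :=
  { g of Vector_isLie R g & Vector R g }.

Notation "[< x , y >]" := (lie_bracket x y)
  (at level 0, x at level 99, y at level 99, format "[< x ,  y >]") : ring_scope.

HB.instance Definition _ (R : fieldType) (g : lieAlgType R) :=
  bilinear_isBilinear.Build R g g g _ _ (@lie_bracket R g)
    (@lie_bracket_linearl R g, @lie_bracket_linearr R g).

Definition lie_abelian (R : fieldType) (g : lieAlgType R) : Prop :=
  forall x y : g, [< x, y >] = 0.

Definition lie_isomorphic (R : fieldType) (g h : lieAlgType R) : Prop :=
  exists f : {linear g -> h},
    bijective f /\ forall x y : g, f [< x, y >] = [< f x, f y >].

Section DirectSum.
Variables (R : fieldType) (g h : lieAlgType R).

Definition prod_bracket (x y : g * h) : g * h :=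
  ([< x.1, y.1 >], [< x.2, y.2 >]).

Fact prod_bracket_linearl y : linear (prod_bracket^~ y).
Proof.
by move=> a u v; congr pair; rewrite /= lie_bracket_linearl.
Qed.

Fact prod_bracket_linearr x : linear (prod_bracket x).
Proof.
by move=> a u v; congr pair; rewrite /= lie_bracket_linearr.
Qed.

Fact prod_bracketxx x : prod_bracket x x = 0.
Proof. by rewrite /prod_bracket !lie_bracketxx. Qed.

Fact prod_jacobi x y z :
  prod_bracket x (prod_bracket y z) + prod_bracket y (prod_bracket z x)
    + prod_bracket z (prod_bracket x y) = 0.
Proof. by congr pair; rewrite /= lie_jacobi. Qed.

HB.instance Definition _ := Vector_isLie.Build R (g * h)%type
  prod_bracket_linearl prod_bracket_linearr prod_bracketxx prod_jacobi.

End DirectSum.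

Definition heisenberg3 (R : fieldType) : Type := 'rV[R]_3.

Section Heisenberg.
Variable R : fieldType.

HB.instance Definition _ := Vector.on (heisenberg3 R).

Definition heis_bracket (x y : heisenberg3 R) : heisenberg3 R :=
  (x 0 0 * y 0 1 - x 0 1 * y 0 0) *: 'e_2%:R.

Fact heis_bracket_linearl y : linear (heis_bracket^~ y).
Proof.
move=> a u v; rewrite /heis_bracket scalerA -scalerDl; congr (_ *: _).
by rewrite !mxE; ring.
Qed.

Fact heis_bracket_linearr x : linear (heis_bracket x).
Proof.
move=> a u v; rewrite /heis_bracket scalerA -scalerDl; congr (_ *: _).
by rewrite !mxE; ring.
Qed.

Fact heis_bracketxx x : heis_bracket x x = 0.
Proof. by rewrite /heis_bracket mulrC subrr scale0r. Qed.

Fact heis_bracket_center x y z : heis_bracket x (heis_bracket y z) = 0.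
Proof. by rewrite {1}/heis_bracket !mxE /= !mulr0 subrr scale0r. Qed.

Fact heis_jacobi x y z :
  heis_bracket x (heis_bracket y z) + heis_bracket y (heis_bracket z x)
    + heis_bracket z (heis_bracket x y) = 0.
Proof. by rewrite !heis_bracket_center !addr0. Qed.

HB.instance Definition _ := Vector_isLie.Build R (heisenberg3 R)
  heis_bracket_linearl heis_bracket_linearr heis_bracketxx heis_jacobi.

Definition heis_basis (i : 'I_3) : heisenberg3 R := 'e_i.

Lemma heis_bracket01 :
  [< heis_basis 0, heis_basis 1 >] = heis_basis 2%:R.
Proof.
by rewrite /lie_bracket /= /heis_bracket !mxE /= mul0r mulr1 subr0 scale1r.
Qed.

Lemma heis_bracketx2 x : [< x, heis_basis 2%:R >] = 0.
Proof.
by rewrite /lie_bracket /= /heis_bracket !mxE /= !mulr0 subrr scale0r.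
Qed.

End Heisenberg.

Section MilnorFrames.
Variables (R : fieldType) (g : lieAlgType R).

(* Indices are taken modulo n: ordS is the cyclic successor on 'I_n.  The two
   nonzero cases are disjoint as soon as n >= 3. *)
Definition milnor_frame n (X : n.-tuple g) : Prop :=
  basis_of {:g} X /\
  exists lambda : 'I_n -> R, forall i j : 'I_n,
    [< tnth X i, tnth X j >] =
      if j == ordS i then lambda (ordS (ordS i)) *: tnth X (ordS (ordS i))
      else if i == ordS j then
        - (lambda (ordS (ordS j)) *: tnth X (ordS (ordS j)))
      else 0.

Definition admits_milnor_frame : Prop :=
  exists X : (\dim {:g}).-tuple g, milnor_frame X.

End MilnorFrames.

Definition lie_metric (R : realType) (g : lieAlgType R) : Type :=
  {dot g for idfun}.

Definition admits_orthonormal_milnor_frame (R : realType) (g : lieAlgType R)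
    (m : lie_metric g) : Prop :=
  exists X : (\dim {:g}).-tuple g, milnor_frame X /\ orthonormal m X.

(* Main.v *)
Require Import Defs.
From HB Require Import structures.
From mathcomp Require Import all_boot all_order all_algebra.
From mathcomp Require Import sesquilinear reals.
From mathcomp Require Import ring.

Set Implicit Arguments.
Unset Strict Implicit.
Unset Printing Implicit Defensive.

Import Order.TTheory GRing.Theory Num.Theory.
Local Open Scope ring_scope.

(** In a frame with [X_i, X_(i+1)] = lambda_(i+2) X_(i+2), the bracket only
    couples consecutive indices, and the coordinate of [x, y] on X_(i+2) is
    lambda_(i+2) (x_i y_(i+1) - x_(i+1) y_i) ([coord_bracket]). The Jacobi
    identity then forces lambda_k lambda_(k+2) = 0 ([milnor_lambda_gap2]): the
    nonzero constants occur alone or in adjacent pairs, and the algebra is a sum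
    of Heisenberg algebras (isolated constants), of four-dimensional filiform
    algebras (adjacent pairs) and of an abelian algebra. Orthonormal Milnor
    frames are excluded by two different obstructions.

    If some adjacent constants lambda_s, lambda_(s+1) are both nonzero, the
    algebra is three-step nilpotent. For an orthonormal Milnor frame, the bracket
    of two vectors orthogonal to [g, g] is orthogonal to [g, [g, g]]
    ([orthonormal_milnor_horizontal]): the brackets of the first kind have
    components only on those X_k for which lambda_(k-1) and lambda_(k-2) vanish,
    those of the second kind only on the other X_k. This fails for the metric in
    which the given frame becomes orthonormal once X_s is replaced with
    X_s - X_(s+1): there X_(s-2) and X_(s-1) are orthogonal to [g, g], their
    bracket is proportional to X_s, and X_(s+1) lies in [g, [g, g]] without being
    orthogonal to X_s.

    If no adjacent constants are both nonzero, the algebra is two-step nilpotent.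
    If only one constant is nonzero it is the sum of a Heisenberg algebra and an
    abelian one ([single_lambda_heisenberg]). Otherwise let s and t be two
    indices with nonzero constants. When the image of ad x is a line, that line
    is spanned by a frame vector ([ad_line_frame_vector]), in any Milnor frame;
    hence, in the presence of an orthonormal Milnor frame, two such lines are
    equal or orthogonal ([orthonormal_milnor_lines]). Since X_s and X_t span two
    such lines, it is enough to choose a metric in which they are not
    orthogonal. *)

(** * The cyclic successor *)

Lemma val_iter_ordS n k (i : 'I_n) :
  iter k (@ordS n) i = ((i + k) %% n)%N :> nat.
Proof.
elim: k => [|k IHk] /=; first by rewrite addn0 modn_small.
by rewrite IHk -addn1 modnDml addn1 addnS.
Qed.

Lemma iter_ordS_neq n k (i : 'I_n) :
  (0 < k < n)%N -> (iter k (@ordS n) i == i) = false.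
Proof.
case/andP=> k0 kn; apply/negbTE/eqP => /(congr1 val) /=; rewrite val_iter_ordS.
rewrite -[RHS](modn_small (ltn_ord i)) -[X in _ = (X %% _)%N]addn0 => /eqP.
by rewrite eqn_modDl mod0n modn_small // -leqn0 leqNgt k0.
Qed.

(** A rewrite rule deciding the comparisons of indices at cyclic distance at most
    three; distance three is where a dimension of at least four matters. *)
Lemma ordS_neq n (n4 : (4 <= n)%N) (i : 'I_n) :
  ((ordS i == i) = false) * ((ordS (ordS i) == i) = false) *
  ((ordS (ordS (ordS i)) == i) = false) *
  ((i == ordS i) = false) * ((i == ordS (ordS i)) = false) *
  ((i == ordS (ordS (ordS i))) = false).
Proof.
rewrite ![i == _]eq_sym.
have h k : (0 < k < 4)%N -> (iter k (@ordS n) i == i) = false.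
  by case/andP=> k0 k4; rewrite iter_ordS_neq // k0 (leq_trans k4).
by rewrite (h 1%N isT) (h 2%N isT) (h 3%N isT).
Qed.

Lemma ordSS_surj n (k : 'I_n) : exists i : 'I_n, k = ordS (ordS i).
Proof. by exists (ord_pred (ord_pred k)); rewrite !ord_predK. Qed.

(** * Coordinates in a basis *)

Section Coordinates.
Variables (R : fieldType) (V : vectType R) (n : nat) (X : n.-tuple V).
Hypothesis Xbasis : basis_of {:V} X.

Lemma coord_sum v : v = \sum_i coord X i v *: tnth X i.
Proof.
rewrite {1}(coord_basis Xbasis (memvf v)).
by apply: eq_bigr => i _; rewrite (tnth_nth 0).
Qed.

Lemma coord_tnth i j : coord X i (tnth X j) = (j == i)%:R.
Proof. by rewrite (tnth_nth 0) coord_free // (basis_free Xbasis). Qed.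

Lemma coord_inj v w : (forall i, coord X i v = coord X i w) -> v = w.
Proof.
move=> h; rewrite (coord_sum v) (coord_sum w).
by apply: eq_bigr => i _; rewrite h.
Qed.

Lemma coord_lincomb a i : coord X i (\sum_j a j *: tnth X j) = a i.
Proof.
under eq_bigr do rewrite (tnth_nth 0).
by rewrite coord_sum_free // (basis_free Xbasis).
Qed.

End Coordinates.

(** * The bracket in a Milnor frame *)

Lemma lie_bracketC (R : fieldType) (g : lieAlgType R) (x y : g) :
  [< x, y >] = - [< y, x >].
Proof.
have := lie_bracketxx (x + y).
rewrite linearDl /= !linearDr /= !lie_bracketxx add0r addr0 => /eqP.
by rewrite addr_eq0 => /eqP.
Qed.

(** The bracket relations of a Milnor frame with its constants made explicit, so
    that they can be named in the lemmas below. *)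
Definition milnor_brackets (R : fieldType) (g : lieAlgType R) n
    (X : n.-tuple g) (lambda : 'I_n -> R) : Prop :=
  forall i j, [< tnth X i, tnth X j >] =
      if j == ordS i then lambda (ordS (ordS i)) *: tnth X (ordS (ordS i))
      else if i == ordS j then
        - (lambda (ordS (ordS j)) *: tnth X (ordS (ordS j)))
      else 0.

Section MilnorFrame.
Variables (R : fieldType) (g : lieAlgType R) (n : nat) (X : n.-tuple g).
Variable lambda : 'I_n -> R.
Hypothesis n4 : (4 <= n)%N.
Hypothesis Xbasis : basis_of {:g} X.
Hypothesis XE : milnor_brackets X lambda.

Local Notation c := (coord X).

Lemma milnor_bracketE x y :
  [< x, y >] = \sum_i (lambda (ordS (ordS i)) *
    (c i x * c (ordS i) y - c (ordS i) x * c i y)) *: tnth X (ordS (ordS i)).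
Proof.
rewrite {1}(coord_sum Xbasis x) {1}(coord_sum Xbasis y).
have -> : [< \sum_i c i x *: tnth X i, \sum_i c i y *: tnth X i >] =
    \sum_i \sum_j (c i x * c j y) *: [< tnth X i, tnth X j >].
  rewrite linear_sumlz; apply: eq_bigr => i _.
  rewrite linear_sumr; apply: eq_bigr => j _.
  by rewrite linearZl_LR linearZr_LR /= scalerA mulrC.
pose A i := tnth X (ordS (ordS i)).
pose b i := lambda (ordS (ordS i)).
have E i j : (c i x * c j y) *: [< tnth X i, tnth X j >] =
   (if j == ordS i then (c i x * c j y * b i) *: A i else 0) -
   (if i == ordS j then (c i x * c j y * b j) *: A j else 0).
  rewrite XE; case: eqP => [->|_].
    by rewrite (ordS_neq n4) subr0 scalerA.
  by case: eqP => [_|_]; rewrite ?subr0 ?scaler0 // scalerN scalerA sub0r.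
under eq_bigr do under eq_bigr do rewrite E.
under eq_bigr do rewrite big_split /= -big_mkcond big_pred1_eq.
rewrite big_split /= (exchange_big _ _ _ _ _ (fun i j => - _)) /= -big_split /=.
apply: eq_bigr => i _.
rewrite sumrN -big_mkcond big_pred1_eq -scalerBl -/(A i) -/(b i); congr (_ *: _).
by ring.
Qed.

Lemma coord_bracket i x y :
  c (ordS (ordS i)) [< x, y >] = lambda (ordS (ordS i)) *
    (c i x * c (ordS i) y - c (ordS i) x * c i y).
Proof.
rewrite milnor_bracketE linear_sum (bigD1 i) //= linearZ /= coord_tnth // eqxx.
rewrite mulr1 big1 ?addr0 // => j ji; rewrite linearZ /= coord_tnth //.
by rewrite !(inj_eq (@ordS_inj n)) (negbTE ji) mulr0.
Qed.

Lemma coord_bracket0 k x y : lambda k = 0 -> c k [< x, y >] = 0.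
Proof. by have [i ->] := ordSS_surj k => l0; rewrite coord_bracket l0 mul0r. Qed.

Lemma bracket_succ i : [< tnth X i, tnth X (ordS i) >] =
  lambda (ordS (ordS i)) *: tnth X (ordS (ordS i)).
Proof. by rewrite XE eqxx. Qed.

(** The only surviving term on X_(i+4) in the Jacobi identity for X_i, X_(i+1),
    X_(i+3) comes from [X_(i+3), [X_i, X_(i+1)]], also in dimension four, where
    X_(i+3) and X_i need not commute. *)
Lemma milnor_lambda_gap2 k : lambda k * lambda (ordS (ordS k)) = 0.
Proof.
have [i ->] := ordSS_surj k.
have := lie_jacobi (tnth X i) (tnth X (ordS i)) (tnth X (ordS (ordS (ordS i)))).
move/(congr1 (c (ordS (ordS (ordS (ordS i)))))).
rewrite !linearD linear0 /= !(coord_bracket (ordS (ordS i))).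
rewrite !coord_bracket // !coord_tnth // !eqxx !(ordS_neq n4) /= => H.
by apply/eqP; rewrite -oppr_eq0 -H; apply/eqP; ring.
Qed.

(** An adjacent pair of nonzero constants is visible in the iterated bracket
    [X_(k-1), [X_(k-2), X_(k-1)]]. Hence having such a pair is a property of the
    Lie algebra, not of the frame. *)
Lemma milnor_two_step :
  (forall k, lambda k * lambda (ordS k) = 0) <->
  (forall x y z : g, [< x, [< y, z >] >] = 0).
Proof.
split=> [l0 x y z|two k]; last first.
  have [i ->] := ordSS_surj k.
  have := two (tnth X (ordS i)) (tnth X i) (tnth X (ordS i)).
  rewrite bracket_succ linearZr_LR /= bracket_succ scalerA.
  move/(congr1 (c (ordS (ordS (ordS i))))).
  by rewrite linearZ linear0 /= coord_tnth // eqxx mulr1.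
apply: (coord_inj Xbasis) => k; rewrite linear0; have [i ->] := ordSS_surj k.
rewrite coord_bracket.
have [/coord_bracket0 ->|li] := eqVneq (lambda i) 0; last first.
  have /eqP := milnor_lambda_gap2 i.
  by rewrite mulf_eq0 (negbTE li) => /eqP->; rewrite mul0r.
have [/coord_bracket0 ->|li] := eqVneq (lambda (ordS i)) 0; first by ring.
have /eqP := l0 (ordS i).
by rewrite mulf_eq0 (negbTE li) => /eqP->; rewrite mul0r.
Qed.

Lemma bracket_first i u : lambda (ordS i) = 0 ->
  [< tnth X i, u >] =
    (lambda (ordS (ordS i)) * c (ordS i) u) *: tnth X (ordS (ordS i)).
Proof.
move=> lSi; apply: (coord_inj Xbasis) => k; have [j ->] := ordSS_surj k.
rewrite coord_bracket linearZ /= !coord_tnth // !(inj_eq (@ordS_inj n)).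
have [ <-|_] := eqVneq i j; first by rewrite (ordS_neq n4) /=; ring.
have [Ej|_] := eqVneq i (ordS j); first by rewrite -Ej lSi /=; ring.
by rewrite /=; ring.
Qed.

Lemma bracket_second i u : lambda (ordS (ordS (ordS i))) = 0 ->
  [< tnth X (ordS i), u >] =
    - (lambda (ordS (ordS i)) * c i u) *: tnth X (ordS (ordS i)).
Proof.
move=> lSSSi; apply: (coord_inj Xbasis) => k; have [j ->] := ordSS_surj k.
rewrite coord_bracket linearZ /= !coord_tnth // !(inj_eq (@ordS_inj n)).
have [ <-|_] := eqVneq i j; first by rewrite (ordS_neq n4) /=; ring.
have [ <-|_] := eqVneq (ordS i) j; first by rewrite lSSSi /=; ring.
by rewrite /=; ring.
Qed.

(** When no two adjacent constants are nonzero, a nonzero coordinate x_i or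
    x_(i+1) of x such that lambda_(i+2) is nonzero is isolated by bracketing x
    with X_(i+1) or X_i: the result is a nonzero multiple of X_(i+2). *)
Lemma ad_line_frame_vector x p v :
  (forall k, lambda k * lambda (ordS k) = 0) ->
  (forall u, exists a, [< x, u >] = a *: p) -> [< x, v >] != 0 ->
  exists k b, p = b *: tnth X k.
Proof.
move=> l0 xp xv.
suff [k [u [a [a0 ux]]]] :
    exists k u a, a != 0 /\ [< u, x >] = a *: tnth X k.
  have [b E] := xp (- u); exists k, (b^-1 * a).
  have {}E : a *: tnth X k = b *: p by rewrite -E linearNr -lie_bracketC.
  have b0 : b != 0.
    apply: contra_neq a0 => b0; move/(congr1 (c k)): E.
    by rewrite b0 scale0r linear0 linearZ /= coord_tnth // eqxx mulr1.
  by rewrite -scalerA E scalerA mulVf // scale1r.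
have : exists i, c (ordS (ordS i)) [< x, v >] != 0.
  apply/existsP; apply: contraNT xv; rewrite negb_exists => /forallP h.
  apply/eqP/(coord_inj Xbasis) => k; have [i ->] := ordSS_surj k.
  by rewrite linear0; apply/eqP/negPn.
case=> i; rewrite coord_bracket mulf_eq0 negb_or => /andP[li xi].
have lSSSi : lambda (ordS (ordS (ordS i))) = 0.
  have /eqP := l0 (ordS (ordS i)).
  by rewrite mulf_eq0 (negbTE li) => /eqP.
have lSi : lambda (ordS i) = 0.
  by have /eqP := l0 (ordS i); rewrite mulf_eq0 (negbTE li) orbF => /eqP.
have [xi0|xi0] := eqVneq (c i x) 0.
  have xSi : c (ordS i) x != 0.
    by apply: contra_neq xi => ->; rewrite xi0 !mul0r subr0.
  exists (ordS (ordS i)), (tnth X i), (lambda (ordS (ordS i)) * c (ordS i) x).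
  by rewrite mulf_neq0 // bracket_first.
exists (ordS (ordS i)), (tnth X (ordS i)), (- (lambda (ordS (ordS i)) * c i x)).
by rewrite oppr_eq0 mulf_neq0 // bracket_second.
Qed.

End MilnorFrame.

(** * Metrics given by coordinates *)

Section Metric.
Variables (R : realType) (g : lieAlgType R).

Lemma metric_of_coordinates n (phi : 'I_n -> {scalar g}) :
  (forall x, (forall i, phi i x = 0) -> x = 0) ->
  exists m : lie_metric g, forall x y, m x y = \sum_i phi i x * phi i y.
Proof.
move=> phi_inj; pose f x y : R := \sum_i phi i x * phi i y.
have f_bilinear : bilinear_for ( *%R : GRing.Scale.law R R)
    (idfun \; *%R : GRing.Scale.law R R) f.
  split=> z a u v; rewrite /f /= mulr_sumr -big_split; apply: eq_bigr => i _ /=.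
    by rewrite linearP /=; ring.
  by rewrite linearP /=; ring.
have f_herm x y : f x y = (-1) ^+ false * idfun (f y x).
  by rewrite mul1r /f; apply: eq_bigr => i _; rewrite mulrC.
have f_pos x : x != 0 -> 0 < f x x.
  move=> x0; rewrite lt_def sumr_ge0 ?andbT; last by move=> i _; apply: sqr_ge0.
  apply: contra_neq x0 => /psumr_eq0P h; apply: phi_inj => i; apply/eqP.
  by rewrite -sqrf_eq0 expr2 h // => j _; apply: sqr_ge0.
pose m : {dot g for idfun} := HB.pack f
  (bilinear_isBilinear.Build R g g R _ _ f f_bilinear)
  (isHermitianSesquilinear.Build R g false idfun f f_herm)
  (isDotProduct.Build R g f f_pos).
by exists m.
Qed.

(** The metric for which the basis becomes orthonormal once X_s is replaced with
    X_s - X_t. *)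
Lemma skewed_metric n (X : n.-tuple g) (s t : 'I_n) :
  basis_of {:g} X -> s != t ->
  exists m : lie_metric g, m (tnth X s) (tnth X t) != 0 /\
    forall j k, j != k -> j != s -> j != t -> m (tnth X j) (tnth X k) = 0.
Proof.
move=> Xbasis st.
(* x_s X_s + x_t X_t = x_s (X_s - X_t) + (x_t + x_s) X_t *)
pose phi i x : R := coord X i x + (i == t)%:R * coord X s x.
have phi_lin i : linear_for *%R (phi i).
  by move=> a u v; rewrite /phi !linearP /=; ring.
pose Phi i : {scalar g} :=
  HB.pack (phi i) (GRing.isLinear.Build R g R *%R (phi i) (phi_lin i)).
have [x phi0|m mE] := @metric_of_coordinates n Phi.
  apply: (coord_inj Xbasis) => i; rewrite linear0.
  have xs : coord X s x = 0.
    by have := phi0 s; rewrite /= /phi (negbTE st) mul0r addr0.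
  by have := phi0 i; rewrite /= /phi xs mulr0 addr0.
exists m; split=> [|j k jk js jt]; rewrite mE /= /phi.
  rewrite (bigD1 t) //= !coord_tnth // !eqxx [t == s]eq_sym (negbTE st) big1.
    by rewrite /= mulr0 mul1r !addr0 add0r mulr1 oner_eq0.
  move=> i it; rewrite !coord_tnth // (negbTE it) [t == i]eq_sym (negbTE it) /=.
  by ring.
apply: big1 => i _; rewrite !coord_tnth // (negbTE js).
have [ji|_] := eqVneq j i; last by rewrite /=; ring.
by rewrite -ji [k == j]eq_sym (negbTE jk) (negbTE jt) /=; ring.
Qed.

Lemma orthonormal_tnth n (Z : n.-tuple g) (m : lie_metric g) :
  orthonormal m Z -> forall i j, m (tnth Z i) (tnth Z j) = (i == j)%:R.
Proof.
case: Z => s /= sz /andP[/allP s1 so] i j.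
rewrite !(tnth_nth 0) /=.
wlog le_ij : i j / (i <= j)%N => [hw|].
  have [/hw//|/ltnW/hw] := leqP i j.
  by rewrite eq_sym => <-; rewrite hermC expr0 mul1r.
have [ <-|ij] := eqVneq i j; first by apply/eqP/s1/mem_nth; rewrite (eqP sz).
have {le_ij ij} : (i < j)%N by rewrite ltn_neqAle le_ij andbT.
move: (ltn_ord j); rewrite -{2}(eqP sz).
move: (nat_of_ord i) (nat_of_ord j) => {s1 sz} {}i {}j.
elim: s so i j => //= v s IHs /andP[/= vs so] [|i] [|j] //= js ij;
  last exact: IHs.
by move: vs; rewrite andbT => /allP/(_ _ (mem_nth 0 js))/eqP.
Qed.

Lemma metric_orthonormal n (Z : n.-tuple g) (m : lie_metric g) :
  basis_of {:g} Z -> orthonormal m Z ->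
  forall x y, m x y = \sum_i coord Z i x * coord Z i y.
Proof.
move=> Zbasis oZ x y.
have mZ i j : m (tnth Z i) (tnth Z j) = (i == j)%:R.
  exact: orthonormal_tnth oZ i j.
rewrite {1}(coord_sum Zbasis x) {1}(coord_sum Zbasis y).
rewrite linear_sumlz; apply: eq_bigr => i _.
rewrite linear_sumr (bigD1 i) //= big1 => [|j ji].
  by rewrite linearZl_LR linearZr_LR /= mZ eqxx addr0 mulr1.
by rewrite linearZl_LR linearZr_LR /= mZ eq_sym (negbTE ji) !mulr0.
Qed.

End Metric.

(** * One nonzero structure constant *)

Definition abelian_lie (R : fieldType) (V : vectType R) : Type := V.

Section AbelianLie.
Variables (R : fieldType) (V : vectType R).

HB.instance Definition _ := Vector.on (abelian_lie V).

Let zero_bracket (x y : abelian_lie V) : abelian_lie V := 0.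

Fact zero_bracket_linearl y : linear (zero_bracket^~ y).
Proof. by move=> a u v; rewrite scaler0 addr0. Qed.

Fact zero_bracket_linearr x : linear (zero_bracket x).
Proof. by move=> a u v; rewrite scaler0 addr0. Qed.

Fact zero_bracketxx x : zero_bracket x x = 0.
Proof. by []. Qed.

Fact zero_jacobi x y z :
  zero_bracket x (zero_bracket y z) + zero_bracket y (zero_bracket z x)
    + zero_bracket z (zero_bracket x y) = 0.
Proof. by rewrite !addr0. Qed.

HB.instance Definition _ := Vector_isLie.Build R (abelian_lie V)
  zero_bracket_linearl zero_bracket_linearr zero_bracketxx zero_jacobi.

Lemma abelian_lieP : lie_abelian (abelian_lie V).
Proof. by []. Qed.

End AbelianLie.

(** X_i, X_(i+1) and lambda X_(i+2) span a Heisenberg algebra, where i + 2 = s;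
    the other frame vectors are central and span a complement. *)
Lemma single_lambda_heisenberg (R : fieldType) (g : lieAlgType R) n
    (X : n.-tuple g) (lambda : 'I_n -> R) (s : 'I_n) :
  (4 <= n)%N -> basis_of {:g} X -> milnor_brackets X lambda ->
  lambda s != 0 -> (forall t, t != s -> lambda t = 0) ->
  exists2 a : lieAlgType R, lie_abelian a &
    lie_isomorphic g (heisenberg3 R * a)%type.
Proof.
move=> n4 Xbasis XE; have [i ->] := ordSS_surj s.
set s0 := ordS (ordS i); set l := lambda s0 => l0 single.
pose I := {j : 'I_n | j \notin [:: i; ordS i; s0]}.
pose a := abelian_lie {ffun I -> R^o}.
exists a; first exact: abelian_lieP.
pose f (x : g) : (heisenberg3 R * a)%type :=
  (coord X i x *: heis_basis R 0 + coord X (ordS i) x *: heis_basis R 1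
    + (l^-1 * coord X s0 x) *: heis_basis R 2%:R,
   [ffun j : I => coord X (val j) x : R^o]).
have f_lin : linear f.
  move=> b u v; congr pair.
    by apply/rowP => k; rewrite !mxE !linearP /=; ring.
  by apply/ffunP => j; rewrite !ffunE linearP.
pose F : {linear g -> (heisenberg3 R * a)%type} :=
  HB.pack f (GRing.isLinear.Build R g (heisenberg3 R * a)%type *:%R f f_lin).
have coord0 k x y : k != s0 -> coord X k [< x, y >] = 0.
  by move=> /single; apply: (coord_bracket0 n4 Xbasis XE).
have [is0 Sis0] : i != s0 /\ ordS i != s0 by rewrite /s0 !(ordS_neq n4).
exists F; split; last first.
  move=> x y; congr pair; last first.
    apply/ffunP => -[j jP]; rewrite !ffunE /=.
    by apply: coord0; apply: contraNneq jP => ->; rewrite !inE eqxx !orbT.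
  rewrite /= (coord0 i) // (coord0 (ordS i)) // !scale0r !add0r.
  rewrite (coord_bracket n4 Xbasis XE) -/s0 -/l mulKf //.
  rewrite /lie_bracket /= /heis_bracket; congr (_ *: _).
  by rewrite !mxE /=; ring.
(* The index i + 2 is the one left over, hence the default value. *)
pose coef (p : (heisenberg3 R * a)%type) (j : 'I_n) : R :=
  if j == i then p.1 0 0 else if j == ordS i then p.1 0 1
  else if insub j is Some k then (p.2 : {ffun I -> R^o}) k else l * p.1 0 2%:R.
exists (fun p => \sum_j coef p j *: tnth X j) => [x|[v w]].
  apply: (coord_inj Xbasis) => j; rewrite coord_lincomb // /coef.
  case: eqP => [->|/eqP ji]; first by rewrite !mxE /=; ring.
  case: eqP => [->|/eqP jSi]; first by rewrite !mxE /=; ring.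
  case: insubP => [k _ kj|]; first by rewrite /= ffunE kj.
  rewrite !inE negbK (negbTE ji) (negbTE jSi) /= => /eqP ->.
  by rewrite !mxE /= !mulr0 !add0r mulr1 mulVKf.
congr pair; last first.
  apply/ffunP => -[j jP]; rewrite !ffunE /= coord_lincomb // /coef.
  rewrite insubT; have := jP; rewrite !inE !negb_or.
  by case/and3P=> /negbTE -> /negbTE ->.
rewrite !coord_lincomb // /coef !eqxx !(ordS_neq n4).
rewrite insubF ?inE ?eqxx ?orbT // mulKf //=.
apply/rowP => k; rewrite !mxE /=.
case: k => -[|[|[|//]]] h; rewrite !mulr0 ?mulr1 ?add0r ?addr0;
  by congr (v 0 _); apply: val_inj.
Qed.

(** * Obstructions to orthonormal Milnor frames *)

Section Obstructions.
Variables (R : realType) (g : lieAlgType R) (n : nat) (Z : n.-tuple g).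
Variables (lambda : 'I_n -> R) (m : lie_metric g).
Hypothesis n4 : (4 <= n)%N.
Hypothesis Zbasis : basis_of {:g} Z.
Hypothesis ZE : milnor_brackets Z lambda.
Hypothesis Zortho : orthonormal m Z.

(** On Z_k, the coordinate of [u, v] is a combination of products of a coordinate
    of index k - 1 with one of index k - 2. At an index where lambda is nonzero,
    the coordinates of u and v vanish, the frame vector then lying in [g, g]; where
    lambda is zero, those of [y, z] vanish. If lambda vanishes at both k - 1 and k - 2, then
    [x, [y, z]] has no component on Z_k, and otherwise [u, v] has none. *)
Lemma orthonormal_milnor_horizontal u v x y z :
  (forall y z, m u [< y, z >] = 0) -> (forall y z, m v [< y, z >] = 0) ->
  m [< u, v >] [< x, [< y, z >] >] = 0.
Proof.
have coord0 w k : (forall y z, m w [< y, z >] = 0) -> lambda k != 0 ->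
    coord Z k w = 0.
  have [i ->] := ordSS_surj k => w0 lk; have := w0 (tnth Z i) (tnth Z (ordS i)).
  rewrite (bracket_succ ZE) linearZr_LR /= (metric_orthonormal Zbasis Zortho).
  rewrite (bigD1 (ordS (ordS i))) //= big1 => [|j ji].
    move/eqP; rewrite mulf_eq0 (negbTE lk) coord_tnth // eqxx mulr1 addr0.
    by move/eqP.
  by rewrite coord_tnth // eq_sym (negbTE ji) mulr0.
move=> u0 v0; rewrite (metric_orthonormal Zbasis Zortho) big1 // => k _.
have [i ->] := ordSS_surj k; rewrite !(coord_bracket n4 Zbasis ZE).
have [li|li] := eqVneq (lambda i) 0; last first.
  by rewrite (coord0 u i) // (coord0 v i) //; ring.
have [lSi|lSi] := eqVneq (lambda (ordS i)) 0; last first.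
  by rewrite (coord0 u (ordS i)) // (coord0 v (ordS i)) //; ring.
by rewrite !(coord_bracket0 n4 Zbasis ZE) //; ring.
Qed.

(** Both lines are spanned by frame vectors, which are equal or orthogonal. *)
Lemma orthonormal_milnor_lines x y v w p q :
  (forall x y z : g, [< x, [< y, z >] >] = 0) ->
  (forall u, exists a, [< x, u >] = a *: p) -> [< x, v >] != 0 ->
  (forall u, exists a, [< y, u >] = a *: q) -> [< y, w >] != 0 ->
  m p q != 0 -> exists a, p = a *: q.
Proof.
move=> /(milnor_two_step n4 Zbasis ZE) l0 xp xv yq yw.
have [k [a ->]] := ad_line_frame_vector n4 Zbasis ZE l0 xp xv.
have [j [b ->]] := ad_line_frame_vector n4 Zbasis ZE l0 yq yw.
rewrite linearZl_LR linearZr_LR /= (orthonormal_tnth Zortho).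
have [->|_] := eqVneq k j; last by rewrite !mulr0 eqxx.
rewrite mulr1 mulf_eq0 negb_or => /andP[_ b0].
by exists (a / b); rewrite scalerA divfK.
Qed.

End Obstructions.

Theorem theorem1p5 (R : realType) (g : lieAlgType R)
    (dim_ge4 : (4 <= \dim {:g})%N)
    (g_nonabelian : ~ lie_abelian g)
    (g_milnor : admits_milnor_frame g)
    (g_not_heis : forall a : lieAlgType R,
      lie_abelian a -> ~ lie_isomorphic g (heisenberg3 R * a)%type) :
  exists m : lie_metric g, ~ admits_orthonormal_milnor_frame m.
Proof.
case: g_milnor => X [Xbasis [lambda XE]].
have n4 := dim_ge4.
(* Three-step case: i, i + 1, i + 2, i + 3 index a filiform subalgebra. *)
have [/existsP[k]|/existsPn noadj] :=
    boolP [exists k, lambda k * lambda (ordS k) != 0].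
  have [i ->] := ordSS_surj k; rewrite mulf_eq0 negb_or => /andP[ls lt].
  have li : lambda i = 0.
    have /eqP := milnor_lambda_gap2 n4 Xbasis XE i.
    by rewrite mulf_eq0 (negbTE ls) orbF => /eqP.
  have lSi : lambda (ordS i) = 0.
    have /eqP := milnor_lambda_gap2 n4 Xbasis XE (ordS i).
    by rewrite mulf_eq0 (negbTE lt) orbF => /eqP.
  have st : ordS (ordS i) != ordS (ordS (ordS i)) by rewrite (ordS_neq n4).
  have [m [mst mX]] := skewed_metric Xbasis st.
  exists m => -[Z [[Zbasis [mu ZE]] Zortho]].
  have perp j : j != ordS (ordS i) -> j != ordS (ordS (ordS i)) ->
      lambda j = 0 -> forall y z, m (tnth X j) [< y, z >] = 0.
    move=> js jt lj y z; rewrite (coord_sum Xbasis [< y, z >]) linear_sumr.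
    apply: big1 => k' _; rewrite linearZr_LR /=.
    have [ <-|jk] := eqVneq j k'.
      by rewrite (coord_bracket0 n4 Xbasis XE) // mul0r.
    by rewrite mX // mulr0.
  have := orthonormal_milnor_horizontal n4 Zbasis ZE Zortho (tnth X (ordS i))
    (tnth X i) (tnth X (ordS i)) (perp i _ _ li) (perp (ordS i) _ _ lSi).
  rewrite !(bracket_succ XE) !linearZr_LR linearZl_LR /=.
  rewrite !(bracket_succ XE) linearZr_LR /=.
  rewrite !(ordS_neq n4) => /(_ isT isT isT isT) /eqP.
  by rewrite !mulf_eq0 (negbTE ls) (negbTE lt) (negbTE mst).
have l0 k : lambda k * lambda (ordS k) = 0 by apply/eqP/negPn.
have two := (milnor_two_step n4 Xbasis XE).1 l0.
have [/existsP[s ls]|/existsPn lam0] := boolP [exists s, lambda s != 0]; last first.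
  case: g_nonabelian => x y; apply: (coord_inj Xbasis) => k; rewrite linear0.
  by apply: (coord_bracket0 n4 Xbasis XE); apply/eqP/negPn.
have [/existsP[t /andP[ts lt]]|/existsPn single] :=
    boolP [exists t, (t != s) && (lambda t != 0)]; last first.
  have [|a a_ab /(g_not_heis a a_ab)//] :=
    single_lambda_heisenberg n4 Xbasis XE ls.
  by move=> t ts; have := single t; rewrite ts => /negPn/eqP.
have [m [mst _]] := skewed_metric Xbasis ts.
exists m => -[Z [[Zbasis [mu ZE]] Zortho]].
have line i u : lambda (ordS (ordS i)) != 0 ->
  exists a, [< tnth X i, u >] = a *: tnth X (ordS (ordS i)).
  move=> li; eexists; apply: (bracket_first n4 Xbasis XE).
  by have /eqP := l0 (ordS i); rewrite mulf_eq0 (negbTE li) orbF => /eqP.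
have tnth_neq0 k : tnth X k != 0.
  by rewrite (basis_not0 Xbasis) // mem_tnth.
have [i Es] := ordSS_surj s; have [j Et] := ordSS_surj t.
rewrite Es in ls mst ts; rewrite Et in lt mst ts.
have bracket_neq0 k : lambda (ordS (ordS k)) != 0 ->
    [< tnth X k, tnth X (ordS k) >] != 0.
  by move=> lk; rewrite (bracket_succ XE) scaler_eq0 negb_or lk tnth_neq0.
have [a] := orthonormal_milnor_lines n4 Zbasis ZE Zortho two
  (fun u => line j u lt) (bracket_neq0 j lt)
  (fun u => line i u ls) (bracket_neq0 i ls) mst.
move/(congr1 (coord X (ordS (ordS j)))); rewrite linearZ /= !coord_tnth // eqxx.
by rewrite eq_sym (negbTE ts) mulr0 => /eqP; rewrite oner_eq0.
Qed.
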